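(* The following relations hold in $U_q(\mathfrak{sl}_2)$: \begin{align*} \nu_x \frac{q\nu_y\nu_z - q^{-1}\nu_z\nu_y}{q-q^{-1}} &= \nu_x - q^{-2}\nu_y - q^2\nu_z + \frac{q^2\nu_y\nu_z-q^{-2}\nu_z\nu_y}{q-q^{-1}},\\ \nu_y \frac{q\nu_z\nu_x - q^{-1}\nu_x\nu_z}{q-q^{-1}} &= \nu_y - q^{-2}\nu_z - q^2\nu_x + \frac{q^2\nu_z\nu_x-q^{-2}\nu_x\nu_z}{q-q^{-1}},\\ \nu_z \frac{q\nu_x\nu_y - q^{-1}\nu_y\nu_x}{q-q^{-1}} &= \nu_z - q^{-2}\nu_x - q^2\nu_y + \frac{q^2\nu_x\nu_y-q^{-2}\nu_y\nu_x}{q-q^{-1}},\\ \frac{q\nu_y\nu_z - q^{-1}\nu_z\nu_y}{q-q^{-1}}\nu_x &= \nu_x - q^{2}\nu_y - q^{-2}\nu_z + \frac{q^2\nu_y\nu_z-q^{-2}\nu_z\nu_y}{q-q^{-1}},\\ \frac{q\nu_z\nu_x - q^{-1}\nu_x\nu_z}{q-q^{-1}}\nu_y &= \nu_y - q^{2}\nu_z - q^{-2}\nu_x + \frac{q^2\nu_z\nu_x-q^{-2}\nu_x\nu_z}{q-q^{-1}},\\ \frac{q\nu_x\nu_y - q^{-1}\nu_y\nu_x}{q-q^{-1}}\nu_z &= \nu_z - q^{2}\nu_x - q^{-2}\nu_y + \frac{q^2\nu_x\nu_y-q^{-2}\nu_y\nu_x}{q-q^{-1}}. \end{align*}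
   Context: $\mathbb K$ is a field and $q$ is a nonzero scalar in $\mathbb K$ with $q^2\neq 1$. $U_q(\mathfrak{sl}_2)$ is the unital associative $\mathbb K$-algebra with generators $x,y,y^{-1},z$ and relations $yy^{-1}=y^{-1}y=1$, $\frac{qxy-q^{-1}yx}{q-q^{-1}}=1$, $\frac{qyz-q^{-1}zy}{q-q^{-1}}=1$, $\frac{qzx-q^{-1}xz}{q-q^{-1}}=1$. In $U_q(\mathfrak{sl}_2)$: $\nu_x=q(1-yz)=q^{-1}(1-zy)$, $\nu_y=q(1-zx)=q^{-1}(1-xz)$, $\nu_z=q(1-xy)=q^{-1}(1-yx)$. *)

(* Defs.v *)
From HB Require Import structures.
From mathcomp Require Import all_boot all_algebra.
From mathcomp Require Import boolp finmap.
From mathcomp Require Import monalg.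

Set Implicit Arguments.
Unset Strict Implicit.
Unset Printing Implicit Defensive.

Import GRing.Theory.
Local Open Scope ring_scope.
Local Open Scope quotient_scope.

Section FreeAlgebra.
Variables (K : fieldType) (I : choiceType).

Definition free_alg := {malg K[{fmonom I}]}.

Definition free_gen (i : I) : free_alg := << fmu i >>.

HB.instance Definition _ := GRing.Lalgebra.on free_alg.

Fact free_alg_scalerAr (c : K) (u v : free_alg) : c *: (u * v) = u * (c *: v).
Proof.
apply/malgP => k; rewrite mcoeffZ.
rewrite (mcoeffMlw _ (fsubset_refl _) (msuppZ_le c v)) mcoeffMl.
rewrite mulr_sumr; apply: eq_bigr => k1 _.
rewrite mulr_sumr; apply: eq_bigr => k2 _.
by rewrite mcoeffZ mulrnAr mulrCA.
Qed.

HB.instance Definition _ :=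
  GRing.Lalgebra_isAlgebra.Build K free_alg free_alg_scalerAr.

Definition fmonom_const1 (m : {fmonom I}) : K := 1.

Fact fmonom_const1_morphism : mmorphism fmonom_const1.
Proof. by split=> // m n; rewrite mulr1. Qed.

HB.instance Definition _ :=
  isMultiplicative.Build {fmonom I} K fmonom_const1 fmonom_const1_morphism.

Definition free_aug : free_alg -> K := mmap idfun fmonom_const1.

HB.instance Definition _ := GRing.RMorphism.on free_aug.
HB.instance Definition _ := GRing.Linear.on free_aug.

Lemma free_aug_gen i : free_aug (free_gen i) = 1.
Proof. by rewrite /free_aug mmapU mulr1. Qed.

End FreeAlgebra.

Section IdealQuotient.
Variables (K : fieldType) (A : algType K) (S : A -> Prop).

Inductive ideal_gen : A -> Prop :=
| ideal_gen_in a of S a : ideal_gen a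
| ideal_gen0 : ideal_gen 0
| ideal_genD a b of ideal_gen a & ideal_gen b : ideal_gen (a + b)
| ideal_genMl a b of ideal_gen b : ideal_gen (a * b)
| ideal_genMr a b of ideal_gen a : ideal_gen (a * b).

Lemma ideal_gen_ker (B : nzRingType) (f : {rmorphism A -> B}) :
  (forall a, S a -> f a = 0) -> forall a, ideal_gen a -> f a = 0.
Proof.
move=> fS a; elim=> {a}; first exact: fS.
- exact: rmorph0.
- by move=> a b _ fa _ fb; rewrite rmorphD fa fb addr0.
- by move=> a b _ fb; rewrite rmorphM fb mulr0.
- by move=> a b _ fa; rewrite rmorphM fa mul0r.
Qed.

Definition ideal_pred (a : A) : bool := `[< ideal_gen a >].

Fact ideal_pred_zmod_closed : zmod_closed ideal_pred.
Proof.
split=> [|a b /asboolP Ia /asboolP Ib]; apply/asboolP; first exact: ideal_gen0.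
by apply: ideal_genD Ia _; rewrite -mulN1r; apply: ideal_genMl.
Qed.

HB.instance Definition _ :=
  GRing.isZmodClosed.Build A ideal_pred ideal_pred_zmod_closed.

Definition ideal_closed : zmodClosed A :=
  GRing.ZmodClosed.clone A ideal_pred _.

(* MathComp provides the ring structure on a quotient only over commutative
   rings; properness of the ideal is needed as algTypes are nontrivial. *)
Definition quot_alg of ~ ideal_gen 1 := Quotient.quot ideal_closed.

Hypothesis proper : ~ ideal_gen 1.
Local Notation Q := (quot_alg proper).

HB.instance Definition _ := GRing.Zmodule.on Q.
HB.instance Definition _ := EqQuotient.on Q.

Definition quot_proj (a : A) : Q := \pi_Q a.

Lemma quot_projP a b : reflect (ideal_gen (a - b)) (quot_proj a == quot_proj b).
Proof.
rewrite /quot_proj.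
have -> : (\pi_Q a == \pi_Q b) = (a - b \in ideal_pred).
  by rewrite (Quotient.idealrBE ideal_closed).
exact: asboolP.
Qed.

Lemma quot_proj_repr (u : Q) : quot_proj (repr u) = u.
Proof. exact: reprK. Qed.

Definition quot_one : Q := quot_proj 1.
Definition quot_mul (u v : Q) : Q := quot_proj (repr u * repr v).
Definition quot_scale (c : K) (u : Q) : Q := quot_proj (c *: repr u).

Fact quot_projB : {morph quot_proj : a b / a - b}.
Proof. by move=> a b; rewrite /quot_proj !piE. Qed.

HB.instance Definition _ := GRing.isZmodMorphism.Build A Q quot_proj quot_projB.

Lemma repr_quot_proj a : ideal_gen (repr (quot_proj a) - a).
Proof. by apply/quot_projP; rewrite quot_proj_repr. Qed.

Lemma quot_mulE a b : quot_mul (quot_proj a) (quot_proj b) = quot_proj (a * b).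
Proof.
apply/eqP/quot_projP.
set a' := repr _; set b' := repr _.
have -> : a' * b' - a * b = (a' - a) * b' + a * (b' - b).
  by rewrite mulrBl mulrBr addrA subrK.
by apply: ideal_genD; [apply: ideal_genMr|apply: ideal_genMl];
   apply: repr_quot_proj.
Qed.

Lemma quot_scaleE c a : quot_scale c (quot_proj a) = quot_proj (c *: a).
Proof.
apply/eqP/quot_projP; rewrite -scalerBr -mulr_algl.
by apply: ideal_genMl; apply: repr_quot_proj.
Qed.

Lemma quot_ind (P : Q -> Prop) : (forall a, P (quot_proj a)) -> forall u, P u.
Proof. by move=> Pp u; rewrite -[u]quot_proj_repr. Qed.

Fact quot_mulA : associative quot_mul.
Proof.
elim/quot_ind=> a; elim/quot_ind=> b; elim/quot_ind=> c.
by rewrite !quot_mulE mulrA.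
Qed.

Fact quot_mul1 : left_id quot_one quot_mul.
Proof. by elim/quot_ind=> a; rewrite quot_mulE mul1r. Qed.

Fact quot_mulr1 : right_id quot_one quot_mul.
Proof. by elim/quot_ind=> a; rewrite quot_mulE mulr1. Qed.

Fact quot_mulDl : left_distributive quot_mul +%R.
Proof.
elim/quot_ind=> a; elim/quot_ind=> b; elim/quot_ind=> c.
by rewrite -raddfD !quot_mulE mulrDl raddfD.
Qed.

Fact quot_mulDr : right_distributive quot_mul +%R.
Proof.
elim/quot_ind=> a; elim/quot_ind=> b; elim/quot_ind=> c.
by rewrite -raddfD !quot_mulE mulrDr raddfD.
Qed.

Fact quot_one_neq0 : quot_one != 0.
Proof.
apply/eqP => /eqP; rewrite -(raddf0 quot_proj) => /quot_projP.
by rewrite subr0.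
Qed.

HB.instance Definition _ := GRing.Zmodule_isNzRing.Build Q
  quot_mulA quot_mul1 quot_mulr1 quot_mulDl quot_mulDr quot_one_neq0.

Fact quot_scaleA c d u :
  quot_scale c (quot_scale d u) = quot_scale (c * d) u.
Proof. by elim/quot_ind: u => a; rewrite !quot_scaleE scalerA. Qed.

Fact quot_scale1 : left_id 1 quot_scale.
Proof. by elim/quot_ind=> a; rewrite quot_scaleE scale1r. Qed.

Fact quot_scaleDr : right_distributive quot_scale +%R.
Proof.
move=> c; elim/quot_ind=> a; elim/quot_ind=> b.
by rewrite -raddfD !quot_scaleE scalerDr raddfD.
Qed.

Fact quot_scaleDl u : {morph quot_scale^~ u : c d / c + d}.
Proof.
by elim/quot_ind: u => a c d; rewrite !quot_scaleE scalerDl raddfD.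
Qed.

HB.instance Definition _ := GRing.Zmodule_isLmodule.Build K Q
  quot_scaleA quot_scale1 quot_scaleDr quot_scaleDl.

Fact quot_scaleAl (c : K) (u v : Q) : c *: (u * v) = (c *: u) * v.
Proof.
elim/quot_ind: u => a; elim/quot_ind: v => b.
by rewrite /GRing.scale /GRing.mul /= !(quot_mulE, quot_scaleE) scalerAl.
Qed.

HB.instance Definition _ := GRing.Lmodule_isLalgebra.Build K Q quot_scaleAl.

Fact quot_scaleAr (c : K) (u v : Q) : c *: (u * v) = u * (c *: v).
Proof.
elim/quot_ind: u => a; elim/quot_ind: v => b.
by rewrite /GRing.scale /GRing.mul /= !(quot_mulE, quot_scaleE) scalerAr.
Qed.

HB.instance Definition _ := GRing.Lalgebra_isAlgebra.Build K Q quot_scaleAr.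

Fact quot_proj_monoid_morphism : monoid_morphism quot_proj.
Proof. by split=> // a b; rewrite -quot_mulE. Qed.

HB.instance Definition _ :=
  GRing.isMonoidMorphism.Build A Q quot_proj quot_proj_monoid_morphism.

Fact quot_proj_scalable : scalable quot_proj.
Proof. by move=> c a; rewrite -quot_scaleE. Qed.

HB.instance Definition _ :=
  GRing.isScalable.Build K A Q *:%R quot_proj quot_proj_scalable.

Lemma quot_proj_eq a b : S (a - b) -> quot_proj a = quot_proj b.
Proof. by move=> Sab; apply/eqP/quot_projP/ideal_gen_in. Qed.

Lemma quot_rel_mul a b : S (a * b - 1) -> quot_proj a * quot_proj b = 1.
Proof. by move/quot_proj_eq; rewrite rmorphM rmorph1. Qed.

End IdealQuotient.

Inductive Uq_gen := GenX | GenY | GenYinv | GenZ.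

Definition Uq_gen_code (g : Uq_gen) : 'I_4 :=
  match g with GenX => 0 | GenY => 1 | GenYinv => 2%:R | GenZ => 3%:R end.

Definition Uq_gen_decode (i : 'I_4) : Uq_gen :=
  match val i with 0 => GenX | 1 => GenY | 2 => GenYinv | _ => GenZ end.

Fact Uq_gen_codeK : cancel Uq_gen_code Uq_gen_decode. Proof. by case. Qed.

HB.instance Definition _ := Choice.copy Uq_gen (can_type Uq_gen_codeK).

Section Uqsl2.
Variables (K : fieldType) (q : K).

Local Notation X := (free_gen K GenX).
Local Notation Y := (free_gen K GenY).
Local Notation Yinv := (free_gen K GenYinv).
Local Notation Z := (free_gen K GenZ).

Definition qcomm (A : algType K) (a b : A) : A :=
  (q - q^-1)^-1 *: (q *: (a * b) - q^-1 *: (b * a)).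

Lemma qcomm_lrmorph (A B : algType K) (f : {lrmorphism A -> B}) a b :
  f (qcomm a b) = qcomm (f a) (f b).
Proof.
have fZ c u : f (c *: u) = c *: f u by exact: linearZ.
have fB u v : f (u - v) = f u - f v by exact: rmorphB.
by rewrite /qcomm fZ fB !fZ !rmorphM.
Qed.

Lemma quot_rel_qcomm (A : algType K) (S : A -> Prop) (S1 : ~ ideal_gen S 1)
    (a b : A) :
  S (qcomm a b - 1) -> qcomm (quot_proj S1 a) (quot_proj S1 b) = 1.
Proof. by move/(quot_proj_eq S1); rewrite rmorph1 qcomm_lrmorph. Qed.

(* Each defining relation u = v is imposed through the relator u - v. *)
Inductive Uq_relator : free_alg K Uq_gen -> Prop :=
| Uq_relYYinv : Uq_relator (Y * Yinv - 1)
| Uq_relYinvY : Uq_relator (Yinv * Y - 1)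
| Uq_relXY : Uq_relator (qcomm X Y - 1)
| Uq_relYZ : Uq_relator (qcomm Y Z - 1)
| Uq_relZX : Uq_relator (qcomm Z X - 1).

Hypotheses (q_neq0 : q != 0) (q2_neq1 : q ^+ 2 != 1).

Fact subqV_neq0 : q - q^-1 != 0.
Proof.
apply: contraNneq q2_neq1 => /eqP; rewrite subr_eq0 => /eqP qV.
by rewrite expr2 {2}qV mulfV.
Qed.

Lemma mul_char1 (A : algType K) (f : {lrmorphism A -> K | *%R}) a b :
  f a = 1 -> f b = 1 -> f (a * b - 1) = 0.
Proof. by move=> fa fb; rewrite rmorphB rmorphM rmorph1 /= fa fb mulr1 subrr. Qed.

Lemma qcomm_char1 (A : algType K) (f : {lrmorphism A -> K | *%R}) a b :
  f a = 1 -> f b = 1 -> f (qcomm a b - 1) = 0.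
Proof.
move=> fa fb; have fZ c u : f (c *: u) = c * f u by exact: linearZ.
have fB u v : f (u - v) = f u - f v by exact: rmorphB.
rewrite fB rmorph1 fZ fB !fZ !rmorphM /= fa fb !mulr1.
by rewrite mulVf ?subqV_neq0 // subrr.
Qed.

Fact Uq_proper : ~ ideal_gen Uq_relator 1.
Proof.
pose f : {lrmorphism free_alg K Uq_gen -> K | *%R} := @free_aug K Uq_gen.
have fE i : f (free_gen K i) = 1 by apply: free_aug_gen.
move=> /(ideal_gen_ker (f := f)) f1.
suff /f1/eqP : forall a, Uq_relator a -> f a = 0 by rewrite rmorph1 oner_eq0.
by move=> a [];
  [exact: mul_char1|exact: mul_char1|exact: qcomm_char1..].
Qed.

Definition Uq : Type := quot_alg Uq_proper.

HB.instance Definition _ := GRing.Algebra.on Uq.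

Definition Uq_x : Uq := quot_proj Uq_proper X.
Definition Uq_y : Uq := quot_proj Uq_proper Y.
Definition Uq_yinv : Uq := quot_proj Uq_proper Yinv.
Definition Uq_z : Uq := quot_proj Uq_proper Z.

Lemma Uq_yyinv : Uq_y * Uq_yinv = 1.
Proof. exact/quot_rel_mul/Uq_relYYinv. Qed.

Lemma Uq_yinvy : Uq_yinv * Uq_y = 1.
Proof. exact/quot_rel_mul/Uq_relYinvY. Qed.

Lemma Uq_xy : qcomm Uq_x Uq_y = 1.
Proof. exact/quot_rel_qcomm/Uq_relXY. Qed.

Lemma Uq_yz : qcomm Uq_y Uq_z = 1.
Proof. exact/quot_rel_qcomm/Uq_relYZ. Qed.

Lemma Uq_zx : qcomm Uq_z Uq_x = 1.
Proof. exact/quot_rel_qcomm/Uq_relZX. Qed.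

Definition nu_x : Uq := q *: (1 - Uq_y * Uq_z).
Definition nu_y : Uq := q *: (1 - Uq_z * Uq_x).
Definition nu_z : Uq := q *: (1 - Uq_x * Uq_y).

Lemma qcomm_eq1 (A : algType K) (a b : A) :
  qcomm a b = 1 -> q *: (1 - a * b) = q^-1 *: (1 - b * a).
Proof.
move/(congr1 (fun u => (q - q^-1) *: u)).
rewrite /qcomm scalerA mulfV ?subqV_neq0 // scale1r scalerBl => E.
apply/eqP; rewrite !scalerBr -subr_eq0 opprD opprK addrACA -E addrACA.
by rewrite subrr addNr addr0.
Qed.

Lemma nu_xE : nu_x = q^-1 *: (1 - Uq_z * Uq_y).
Proof. exact/qcomm_eq1/Uq_yz. Qed.

Lemma nu_yE : nu_y = q^-1 *: (1 - Uq_x * Uq_z).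
Proof. exact/qcomm_eq1/Uq_zx. Qed.

Lemma nu_zE : nu_z = q^-1 *: (1 - Uq_y * Uq_x).
Proof. exact/qcomm_eq1/Uq_xy. Qed.

End Uqsl2.

(* Main.v *)
Require Import Defs.
From mathcomp Require Import all_boot all_algebra.
From mathcomp Require Import ring.

Import GRing.Theory.
Local Open Scope ring_scope.

(** Write [a, b] for the normalised q-commutator of the definitions, so that
    the equitable relations read [x, y] = [y, z] = [z, x] = 1.  They are
    invariant under the rotation x -> y -> z -> x, which permutes the six
    identities in two orbits; hence one identity of each orbit, proved for any
    three elements of any algebra that satisfy these relations, suffices.

    The point is that [nu_y, nu_z] = 1 - x^2 ([qcomm_nu]).  It turns the left
    sides into nu_x - nu_x x^2 and nu_x - x^2 nu_x, and it also
    eliminates one of the two products nu_y nu_z, nu_z nu_y from the fraction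
    on the right sides ([qcomm_sqr_l], [qcomm_sqr_r]).  What remains is to
    compute nu_x x^2 and x^2 nu_x ([nu_mul_sqr], [sqr_mul_nu]): absorb one x
    into nu_x, using y (z x) = y (1 - q^-1 nu_y); move the other x across nu_y,
    with which it q-commutes ([nu_qcommute]); finally replace the product y x
    that has appeared by 1 - q nu_z.  This describes nu_x x^2; reading the
    products from right to left gives x^2 nu_x. *)

Section Equitable.
Variables (K : fieldType) (q : K).
Hypotheses (q_neq0 : q != 0) (q2_neq1 : q ^+ 2 != 1).

Let d_neq0 : q - q^-1 != 0. Proof. exact: subqV_neq0. Qed.
Let qq_neq0 : q * q - 1 != 0. Proof. by rewrite subr_eq0. Qed.

Section Fractions.
Variables (A : algType K) (a b : A).

(** Subtracting q times the q-commutator leaves only b a, with coefficient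
    (1 - q^-2) / (q - q^-1) = q^-1. *)
Lemma qcomm_sqr_l :
  (q - q^-1)^-1 *: (q ^+ 2 *: (a * b) - q ^- 2 *: (b * a)) =
  q *: qcomm q a b + q^-1 *: (b * a).
Proof.
rewrite /qcomm !scalerBr !scalerA -addrA; congr (_ + _).
  by congr (_ *: _); ring.
rewrite -!scaleNr -scalerDl; congr (_ *: _).
by field; rewrite q_neq0 qq_neq0.
Qed.

Lemma qcomm_sqr_r :
  (q - q^-1)^-1 *: (q ^+ 2 *: (a * b) - q ^- 2 *: (b * a)) =
  q^-1 *: qcomm q a b + q *: (a * b).
Proof.
rewrite /qcomm !scalerBr !scalerA addrAC; congr (_ + _).
  rewrite -scalerDl; congr (_ *: _).
  by field; rewrite q_neq0 qq_neq0.
by rewrite -!scaleNr; congr (_ *: _); by field; rewrite q_neq0 qq_neq0.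
Qed.

Lemma qcomm_mulE : qcomm q a b = 1 ->
  q *: (a * b) - q^-1 *: (b * a) = (q - q^-1)%:A.
Proof. by move=> <-; rewrite /qcomm scalerA mulfV // scale1r. Qed.

End Fractions.

Section Nu.
Variables (A : algType K) (a b : A).

(** The elements nu_x, nu_y, nu_z are its values at the pairs (y, z), (z, x)
    and (x, y), so that the rotation acts on them through the arguments. *)
Definition nu : A := q *: (1 - a * b).

Lemma mul_nuE : a * b = 1 - q^-1 *: nu.
Proof. by rewrite /nu scalerA mulVf // scale1r subKr. Qed.

Hypothesis ab1 : qcomm q a b = 1.

Lemma nuE : nu = q^-1 *: (1 - b * a).
Proof. exact: qcomm_eq1. Qed.

Lemma mul_nuEr : b * a = 1 - q *: nu.
Proof. by rewrite nuE scalerA mulfV // scale1r subKr. Qed.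

(** Both sides are multiples of b - b a b, read from the two expressions of
    nu. *)
Lemma nu_qcommute : b * nu = q ^+ 2 *: (nu * b).
Proof.
rewrite {2}nuE /nu -scalerAr -scalerAl scalerA mulrBr mulrBl mulr1 mul1r mulrA.
by congr (_ *: _); field.
Qed.

End Nu.

Section Triple.
Variables (A : algType K) (x y z : A).
Hypotheses (xy1 : qcomm q x y = 1) (yz1 : qcomm q y z = 1)
  (zx1 : qcomm q z x = 1).
Local Notation nx := (nu _ y z).
Local Notation ny := (nu _ z x).
Local Notation nz := (nu _ x y).

(** Each nu has two expressions; choose them so that both nu_y nu_z and
    nu_z nu_y carry x at their outer ends.  Then the quartic terms combine to
    - x (q y z - q^-1 z y) x = - (q - q^-1) x^2, and the quadratic ones are
    reduced to constants by the relations for (x, y) and (z, x). *)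
Lemma qcomm_nu : qcomm q ny nz = 1 - x ^+ 2.
Proof.
have E1 : q *: (ny * nz) =
    q^-1 *: 1 - q^-1 *: (x * z) - q^-1 *: (y * x) + x * (q^-1 *: (z * y)) * x.
  rewrite (nuE _ _ _ zx1) (nuE _ _ _ xy1) -scalerAl -scalerAr !scalerA.
  rewrite mulfV // mul1r.
  rewrite mulrBl mul1r mulrBr mulr1 -scalerAr -scalerAl !mulrA.
  by rewrite -!scalerBr -scalerDr opprB !addrA [in LHS](ACl (1*4*2*3)).
have E2 : q^-1 *: (nz * ny) =
    q *: 1 - q *: (x * y) - q *: (z * x) + x * (q *: (y * z)) * x.
  rewrite /nu -scalerAl -scalerAr !scalerA mulVf // mul1r.
  rewrite mulrBl mul1r mulrBr mulr1 -scalerAr -scalerAl !mulrA.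
  by rewrite -!scalerBr -scalerDr opprB !addrA [in LHS](ACl (1*4*2*3)).
have cyz : q^-1 *: (z * y) = q *: (y * z) - (q - q^-1)%:A.
  by rewrite -(qcomm_mulE _ _ _ yz1) subKr.
have cxz : q^-1 *: (x * z) = q *: (z * x) - (q - q^-1)%:A.
  by rewrite -(qcomm_mulE _ _ _ zx1) subKr.
have cyx : q^-1 *: (y * x) = q *: (x * y) - (q - q^-1)%:A.
  by rewrite -(qcomm_mulE _ _ _ xy1) subKr.
rewrite /qcomm E1 E2 cyz cxz cyx.
have -> : x * (q *: (y * z) - (q - q^-1)%:A) * x =
    x * (q *: (y * z)) * x - (q - q^-1) *: x ^+ 2.
  by rewrite mulrBr mulrBl -[in X in _ - X]scalerAr -scalerAl mulr1 expr2.
(* With the constants separated off, only the additive structure of the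
   algebra matters. *)
suff -> : forall (e f g h : A), q^-1 *: 1 - (e - (q - q^-1)%:A)
     - (f - (q - q^-1)%:A) + (g - (q - q^-1) *: h)
     - (q *: 1 - f - e + g) = (q - q^-1) *: (1 - h).
  by rewrite scalerA mulVf // scale1r.
move=> e f g h; rewrite scalerBr.
rewrite -[in RHS](addKr (q *: 1 - f - e + g) (_ - _)) addrC; congr (_ + _).
have -> : q *: 1 = q^-1 *: 1 + (q - q^-1)%:A :> A.
  by rewrite -scalerDl addrC subrK.
by rewrite !opprB !addrA [LHS](ACl (1*2*5*3*6*4*7)).
Qed.

(** nu_x x = q (x - y) + y nu_y.  The second x reaches y after q-commuting
    with nu_y, and y x = 1 - q nu_z. *)
Lemma nu_mul_sqr :
  nx * x ^+ 2 =
  q *: (x ^+ 2 - 1) + q ^+ 2 *: nz + q ^- 2 *: ny - q^-1 *: (nz * ny).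
Proof.
have nxx : nx * x = q *: (x - y) + y * ny.
  rewrite {1}/nu -scalerAl mulrBl mul1r -mulrA (mul_nuE _ z x).
  rewrite mulrBr mulr1 opprB addrCA addrC -scalerAr !scalerDr scalerA mulfV //.
  by rewrite scale1r.
have nyx : ny * x = q ^- 2 *: (x * ny).
  by rewrite (nu_qcommute _ _ _ zx1) scalerA mulVf ?expf_neq0 // scale1r.
rewrite expr2 mulrA nxx mulrDl -mulrA nyx -scalerAr mulrA -scalerAl mulrBl.
rewrite (mul_nuEr _ _ _ xy1) mulrBl mul1r -scalerAl [q ^- 2 *: (_ - _)]scalerBr.
rewrite (scalerA (q ^- 2) q (nz * ny)) {2}expr2 invfM mulfVK // -expr2.
rewrite !(scalerBr q) (scalerA q q nz) opprB !addrA.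
by rewrite [in LHS](addrAC (q *: _)).
Qed.

(** Mirror image of [nu_mul_sqr]: x nu_x = q^-1 (x - y) + nu_y y, and the second
    x meets y in the order x y = 1 - q^-1 nu_z. *)
Lemma sqr_mul_nu :
  x ^+ 2 * nx =
  q^-1 *: (x ^+ 2 - 1) + q ^- 2 *: nz + q ^+ 2 *: ny - q *: (ny * nz).
Proof.
have xnx : x * nx = q^-1 *: (x - y) + ny * y.
  rewrite (nuE _ _ _ yz1) -scalerAr mulrBr mulr1 mulrA (mul_nuEr _ _ _ zx1).
  rewrite mulrBl mul1r opprB addrCA addrC -scalerAl !scalerDr scalerA mulVf //.
  by rewrite scale1r.
rewrite expr2 -mulrA xnx mulrDr mulrA (nu_qcommute _ _ _ zx1) -scalerAl -mulrA.
rewrite -scalerAr mulrBr.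
rewrite (mul_nuE _ x y) mulrBr mulr1 -scalerAr [q ^+ 2 *: (_ - _)]scalerBr.
rewrite (scalerA (q ^+ 2) q^-1 (ny * nz)) {3}expr2 mulfK // -expr2.
rewrite !(scalerBr q^-1) (scalerA q^-1 q^-1 nz) -invfM -expr2.
by rewrite opprB !addrA [in LHS](addrAC (q^-1 *: _)).
Qed.

Lemma nu_mul_qcomm :
  nx * qcomm q ny nz =
  nx - q ^- 2 *: ny - q ^+ 2 *: nz
  + (q - q^-1)^-1 *: (q ^+ 2 *: (ny * nz) - q ^- 2 *: (nz * ny)).
Proof.
rewrite qcomm_sqr_l qcomm_nu mulrBr mulr1 nu_mul_sqr.
rewrite -[1 - x ^+ 2]opprB scalerN !opprD opprK !addrA.
by rewrite [LHS](ACl (1*4*3*2*5)).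
Qed.

Lemma qcomm_mul_nu :
  qcomm q ny nz * nx =
  nx - q ^+ 2 *: ny - q ^- 2 *: nz
  + (q - q^-1)^-1 *: (q ^+ 2 *: (ny * nz) - q ^- 2 *: (nz * ny)).
Proof.
rewrite qcomm_sqr_r qcomm_nu mulrBl mul1r sqr_mul_nu.
rewrite -[1 - x ^+ 2]opprB scalerN !opprD opprK !addrA.
by rewrite [LHS](ACl (1*4*3*2*5)).
Qed.

End Triple.
End Equitable.

Theorem lemma3p10 (K : fieldType) (q : K)
  (q_neq0 : q != 0) (q2_neq1 : q ^+ 2 != 1) :
  let nx : Uq q_neq0 q2_neq1 := nu_x q_neq0 q2_neq1 in
  let ny : Uq q_neq0 q2_neq1 := nu_y q_neq0 q2_neq1 in
  let nz : Uq q_neq0 q2_neq1 := nu_z q_neq0 q2_neq1 in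
  let d := q - q^-1 in
  (nx * (d^-1 *: (q *: (ny * nz) - q^-1 *: (nz * ny)))
     = nx - q ^- 2 *: ny - q ^+ 2 *: nz
       + d^-1 *: (q ^+ 2 *: (ny * nz) - q ^- 2 *: (nz * ny))) /\
  (ny * (d^-1 *: (q *: (nz * nx) - q^-1 *: (nx * nz)))
     = ny - q ^- 2 *: nz - q ^+ 2 *: nx
       + d^-1 *: (q ^+ 2 *: (nz * nx) - q ^- 2 *: (nx * nz))) /\
  (nz * (d^-1 *: (q *: (nx * ny) - q^-1 *: (ny * nx)))
     = nz - q ^- 2 *: nx - q ^+ 2 *: ny
       + d^-1 *: (q ^+ 2 *: (nx * ny) - q ^- 2 *: (ny * nx))) /\
  ((d^-1 *: (q *: (ny * nz) - q^-1 *: (nz * ny))) * nx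
     = nx - q ^+ 2 *: ny - q ^- 2 *: nz
       + d^-1 *: (q ^+ 2 *: (ny * nz) - q ^- 2 *: (nz * ny))) /\
  ((d^-1 *: (q *: (nz * nx) - q^-1 *: (nx * nz))) * ny
     = ny - q ^+ 2 *: nz - q ^- 2 *: nx
       + d^-1 *: (q ^+ 2 *: (nz * nx) - q ^- 2 *: (nx * nz))) /\
  ((d^-1 *: (q *: (nx * ny) - q^-1 *: (ny * nx))) * nz
     = nz - q ^+ 2 *: nx - q ^- 2 *: ny
       + d^-1 *: (q ^+ 2 *: (nx * ny) - q ^- 2 *: (ny * nx))).

Proof.
have xy := Uq_xy q_neq0 q2_neq1.
have yz := Uq_yz q_neq0 q2_neq1.
have zx := Uq_zx q_neq0 q2_neq1.
move=> nx ny nz d.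
split; first exact: nu_mul_qcomm xy yz zx.
split; first exact: nu_mul_qcomm yz zx xy.
split; first exact: nu_mul_qcomm zx xy yz.
split; first exact: qcomm_mul_nu xy yz zx.
split; first exact: qcomm_mul_nu yz zx xy.
exact: qcomm_mul_nu zx xy yz.
Qed.
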